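(* Let $G=(V,E)$ be a simple connected undirected graph with $n\ge 2$ nodes. Then there exists a port numbering of $G$ under which $G$ has a witness cycle of length at most $4\frac{1}{3}n-4$. Equivalently, with this port numbering, an oblivious agent following the Right-Hand-on-the-Wall rule visits all nodes of $G$ periodically with period at most $4\frac{1}{3}n-4$.
   Context: A port numbering of $G$ assigns to each node $v$ of degree $d_v$ a bijection from the set of edges incident to $v$ onto $\{1,\dots,d_v\}$; the value assigned to edge $e$ at $v$ is the port number of $e$ at $v$. Let $\overrightarrow{G}$ be the symmetric digraph obtained by replacing each edge $\{u,v\}$ by the two arcs $(u,v)$ and $(v,u)$. Given a port numbering, the right-hand successor of an arc $(u,v)$ is the arc $(v,w)$ such that the port number of $\{v,w\}$ at $v$ equals $(i \bmod d_v)+1$, where $i$ is the port number of $\{u,v\}$ at $v$. (This is the move of the Right-Hand-on-the-Wall agent: entering $v$ by port $i$, it leaves by port $(i\bmod d_v)+1$.) The successor map is a permutation of the arcs; its cycles are called RH-cycles. A witness cycle is an RH-cycle such that every node of $G$ is an endpoint of some arc of the cycle; its length is its number of arcs. *)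

(* Defs.v *)
From HB Require Import structures.
From mathcomp Require Import all_boot all_order all_algebra all_fingroup.
Set Implicit Arguments.
Unset Strict Implicit.
Unset Printing Implicit Defensive.

Record sgraph (T : finType) := SGraph {
  adj :> rel T;
  adj_sym : symmetric adj;
  adj_irr : irreflexive adj
}.

Section Graph.
Variables (T : finType) (G : sgraph T).

Definition sg_connected := forall u v : T, connect G u v.

Definition edges : {set {set T}} := [set [set u; v] | u in T, v in G u].

Definition incident (v : T) : {set {set T}} := [set e in edges | v \in e].

Definition deg (v : T) : nat := #|incident v|.

(* [port v e] is meaningful only when [e] is an edge incident to [v]. *)
Record port_numbering := PortNumbering {
  port :> T -> {set T} -> nat;
  port_inj : forall v, {in incident v &, injective (port v)};
  port_onto : forall v i,
    (i \in [seq port v e | e in incident v]) = (1 <= i <= deg v)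
}.

Definition sg_arc := {a : T * T | G a.1 a.2}.

Definition src (a : sg_arc) : T := (val a).1.
Definition tgt (a : sg_arc) : T := (val a).2.
Definition arc_edge (a : sg_arc) : {set T} := [set src a; tgt a].

Lemma arc_edge_incident (a : sg_arc) :
  (arc_edge a \in incident (src a)) && (arc_edge a \in incident (tgt a)).
Proof.
have E : arc_edge a \in edges by apply: imset2_f => //; exact: (valP a).
by rewrite !inE E !eqxx orbT.
Qed.

Lemma incident_arc v e : e \in incident v ->
  exists2 a : sg_arc, src a = v & arc_edge a = e.
Proof.
rewrite inE => /andP[/imset2P[x y _ gxy ->]].
rewrite !inE => /orP[] /eqP->; first by exists (Sub (x, y) gxy).
have gyx : G y x by rewrite adj_sym.
by exists (Sub (y, x) gyx); rewrite // /arc_edge /src /tgt /= setUC.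
Qed.

Lemma arc_eq_src (a b : sg_arc) :
  src a = src b -> arc_edge a = arc_edge b -> a = b.
Proof.
rewrite /arc_edge => sE eE.
have tE : tgt a = tgt b.
  have : tgt a \in [set src b; tgt b] by rewrite -eE !inE eqxx orbT.
  rewrite !inE => /orP[] /eqP // aE.
  by have := valP a; rewrite -/(src a) -/(tgt a) aE sE adj_irr.
by apply: val_inj; rewrite [LHS]surjective_pairing [RHS]surjective_pairing; congr pair.
Qed.

Lemma arc_eq_tgt (a b : sg_arc) :
  tgt a = tgt b -> arc_edge a = arc_edge b -> a = b.
Proof.
rewrite /arc_edge => tE eE.
have sE : src a = src b.
  have : src a \in [set src b; tgt b] by rewrite -eE !inE eqxx.
  rewrite !inE => /orP[] /eqP // aE.
  by have := valP a; rewrite -/(src a) -/(tgt a) aE tE adj_irr.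
by apply: val_inj; rewrite [LHS]surjective_pairing [RHS]surjective_pairing; congr pair.
Qed.

Variable p : port_numbering.

Definition next_port (v : T) (i : nat) : nat := (i %% deg v).+1.

Definition rh_succ (a b : sg_arc) : bool :=
  (src b == tgt a) &&
  (p (tgt a) (arc_edge b) == next_port (tgt a) (p (tgt a) (arc_edge a))).

Lemma rh_succ_ex (a : sg_arc) : exists b, rh_succ a b.
Proof.
have /andP[_ inc] := arc_edge_incident a.
have : next_port (tgt a) (p (tgt a) (arc_edge a)) \in
       [seq p (tgt a) e | e in incident (tgt a)].
  by rewrite port_onto /next_port /= ltn_mod; apply/card_gt0P; exists (arc_edge a).
case/imageP => e einc pE; have [b sb eb] := incident_arc einc.
by exists b; rewrite /rh_succ sb eb pE !eqxx.
Qed.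

Definition rh_next (a : sg_arc) : sg_arc := xchoose (rh_succ_ex a).

Lemma rh_nextP (a : sg_arc) : rh_succ a (rh_next a).
Proof. exact: xchooseP. Qed.

Lemma rh_succE (a b : sg_arc) : rh_succ a b = (rh_next a == b).
Proof.
apply/idP/eqP => [/andP[/eqP sb /eqP pb] | <-]; last exact: rh_nextP.
have /andP[/eqP sn /eqP pn] := rh_nextP a.
apply: arc_eq_src; first by rewrite sn sb.
apply: (@port_inj p (tgt a)); last by rewrite pn pb.
- by rewrite -sn; case/andP: (arc_edge_incident (rh_next a)).
- by rewrite -sb; case/andP: (arc_edge_incident b).
Qed.

Lemma next_port_inj v i j : 1 <= i <= deg v -> 1 <= j <= deg v ->
  next_port v i = next_port v j -> i = j.
Proof.
rewrite /next_port => /andP[i0 il] /andP[j0 jl] [].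
case: (ltngtP i (deg v)) il => // [il|iE] _;
  case: (ltngtP j (deg v)) jl => // [jl|jE] _.
- by rewrite !modn_small.
- by rewrite jE modnn modn_small // => iE; rewrite iE in i0.
- by rewrite iE modnn modn_small // => jE; rewrite -jE in j0.
- by rewrite iE jE.
Qed.

Lemma rh_next_inj : injective rh_next.
Proof.
move=> a b ab.
have /andP[/eqP sa /eqP pa] := rh_nextP a.
have /andP[/eqP sb /eqP pb] := rh_nextP b.
have tE : tgt a = tgt b by rewrite -sa -sb ab.
have /andP[_ ia] := arc_edge_incident a.
have /andP[_ ib] := arc_edge_incident b.
rewrite -tE in ib pb.
apply: arc_eq_tgt => //; apply: (@port_inj p (tgt a)) => //.
apply: (@next_port_inj (tgt a)); rewrite -?(port_onto p) ?image_f //.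
by rewrite -pa -pb ab.
Qed.

Definition rh_perm : {perm sg_arc} := perm rh_next_inj.

Definition rh_cycles : {set {set sg_arc}} := porbits rh_perm.

Definition witness_cycle (C : {set sg_arc}) : Prop :=
  C \in rh_cycles /\
  forall v : T, exists2 a, a \in C & v \in arc_edge a.

(* The sequence of nodes occupied by the agent; its first move is free and
   every later move obeys the rule. *)
Definition rh_walk (x : nat -> T) : Prop :=
  forall t, G (x t) (x t.+1) /\
    p (x t.+1) [set x t.+1; x t.+2] =
    next_port (x t.+1) (p (x t.+1) [set x t; x t.+1]).

Definition visits_all_with_period (x : nat -> T) (k : nat) : Prop :=
  [/\ 0 < k,
      forall t, x (t + k) = x t
    & forall (v : T) (s : nat), exists2 t, s <= t < s + k & x t = v].

End Graph.

(* Main.v *)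
Require Import Defs.
From mathcomp Require Import all_boot all_order all_algebra all_fingroup.
From mathcomp Require Import zify lra.
Set Implicit Arguments.
Unset Strict Implicit.
Unset Printing Implicit Defensive.

(* Let [B] be the edge set of a spanning tree. Among the even subgraphs of
   [G \ B], let [D] be one that covers a maximal set of nodes and, subject to
   that, has the fewest edges. Decompose [D] into node-disjoint closed trails, of
   which there are at most [n/3] since each has at least three nodes; taking
   every other edge of each trail gives [N], with an edge at every node covered
   by [D] and [2|N| <= |D| + n/3]. Let [W] be the set of edges of [G \ B] with an
   endpoint not covered by [D]. If [W :|: (D \ N)] contained a nonempty even set
   [C], then [D + C] would cover all that [D] covers, and either cover more nodes
   or have fewer edges. So [W :|: (D \ N)] is a forest, and traversing the edges
   of [B] and [W] in both directions and the trails of [D] in one takes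
   [2(n-1) + 2|W| + |D| <= 4(n-1) + n/3] arcs.

   At each node, either all incident edges are traversed in both directions or
   some edge is traversed in one direction only, so the rotation can be chosen
   to make this set of arcs a union of RH-cycles. A longest such cycle, over all
   such rotations, visits every node: otherwise an edge of [B] leaves the set of
   nodes that it visits, and a 3-cycle modification of the rotation lengthens
   it. *)

(** * Permutations *)

Section Perm.
Variable D : finType.
Implicit Types (s t : {perm D}) (x y z w : D).

Lemma porbit_mem1 s x y : (s x \in porbit s y) = (x \in porbit s y).
Proof. by rewrite -!eq_porbit_mem -(porbit_perm s 1 x) expg1. Qed.

Lemma porbit_memV s x y : (s^-1%g x \in porbit s y) = (x \in porbit s y).
Proof. by rewrite -{2}(permKV s x) porbit_mem1. Qed.

Lemma fconnect_porbit s x y : (y \in porbit s x) = fconnect s x y.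
Proof.
apply/porbitP/idP => [[i ->]|xy]; first by rewrite permX fconnect_iter.
by exists (findex s x y); rewrite permX iter_findex.
Qed.

(** Transposing points of two different orbits glues these orbits into one. *)
Lemma card_porbits_merge s x y :
  x \notin porbit s y -> #|porbits (tperm x y * s)%g| < #|porbits s|.
Proof.
move=> xy; have := porbits_mul_tperm s x y; rewrite xy /=.
have -> : x != y by apply: contra xy => /eqP->; exact: porbit_id.
lia.
Qed.

(* Multiplying by the first transposition splits the common orbit into one
   containing [x] and one containing [y]; the second glues [z] back to the
   piece that it left. *)
Lemma porbits_mul_cycle3 s x y z :
    x != y -> x != z -> y != z -> x \in porbit s y ->
  exists t, [/\ #|porbits (t * s)%g| = #|porbits s|,
    t x != x, {homo t : w / w \in [:: x; y; z]}
    & forall w, w \notin [:: x; y; z] -> t w = w].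
Proof.
move=> xy xz yz sxy; pose s1 := (tperm x y * s)%g.
have := porbits_mul_tperm s x y; rewrite sxy xy /= -/s1 => E1.
have := porbits_mul_tperm s1 x y; rewrite /= tpermKg xy => E2.
have nxy : x \notin porbit s1 y by case: (x \in _) E2 => //= E2; lia.
have [szy|szy] := boolP (y \in porbit s1 z).
  have nxz : x \notin porbit s1 z.
    by move: szy; rewrite porbit_sym -eq_porbit_mem => /eqP->.
  exists (tperm x z * tperm x y)%g; split.
  - rewrite -mulgA -/s1; have := porbits_mul_tperm s1 x z; rewrite nxz xz /= => E3.
    by apply: (@addIn 2); apply: (etrans E3); move: E1; lia.
  - by rewrite permM tpermL tpermD // 1?eq_sym.
  - move=> w; rewrite !inE permM => H.
    by case: (tpermP x z w) => [_|_|_ _]; case: tpermP => [_|_|_ _]; rewrite ?eqxx ?orbT.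
  - move=> w; rewrite !inE !negb_or => /and3P[wx wy wz].
    by rewrite permM !tpermD // 1?eq_sym.
exists (tperm y z * tperm x y)%g; split.
- rewrite -mulgA -/s1; have := porbits_mul_tperm s1 y z; rewrite szy yz /= => E3.
  by apply: (@addIn 2); apply: (etrans E3); move: E1; lia.
- by rewrite permM [tperm y z x]tpermD ?tpermL eq_sym.
- move=> w; rewrite !inE permM => H.
  by case: (tpermP y z w) => [_|_|_ _]; case: tpermP => [_|_|_ _]; rewrite ?eqxx ?orbT.
- move=> w; rewrite !inE !negb_or => /and3P[wx wy wz].
  by rewrite permM !tpermD // 1?eq_sym.
Qed.

(** Only the step out of [x] changes, so the [s]-path running backwards from [x] through its orbit
    is still followed by [s']. The new orbit thus contains the old one, together with [s' x]. *)
Lemma porbit_proper s s' x :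
    (forall w, w \in porbit s x -> w != x -> s' w = s w) ->
  s' x \notin porbit s x -> porbit s x \proper porbit s' x.
Proof.
move=> ss' s'x; apply/properP; split; last first.
  by exists (s' x); rewrite // porbit_mem1 porbit_id.
have step y : y \in porbit s x -> y \in porbit s' x -> s^-1%g y \in porbit s' x.
  move=> ys ys'; have [->|nx] := eqVneq (s^-1%g y) x; first exact: porbit_id.
  by rewrite -porbit_mem1 ss' ?permKV // porbit_memV.
apply/subsetP => y; rewrite -porbitV => /porbitP[i ->{y}].
elim: i => [|i IH]; first by rewrite expg0 perm1 porbit_id.
by rewrite expgSr permM step // -porbitV mem_porbit.
Qed.

End Perm.

(** * Arcs and rotation systems *)

Section Arcs.
Variables (T : finType) (G : sgraph T).
Local Notation arc := (sg_arc G).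
Implicit Types (a b x y z : arc) (u v w : T).

Lemma rev_arc_adj a : G (tgt a, src a).1 (tgt a, src a).2.
Proof. by rewrite /= adj_sym; exact: (valP a). Qed.

Definition rev_arc a : arc := Sub (tgt a, src a) (rev_arc_adj a).

Lemma src_rev a : src (rev_arc a) = tgt a. Proof. by []. Qed.
Lemma tgt_rev a : tgt (rev_arc a) = src a. Proof. by []. Qed.

Lemma arc_edge_rev a : arc_edge (rev_arc a) = arc_edge a.
Proof. by rewrite /arc_edge src_rev tgt_rev setUC. Qed.

Lemma arc_ext a b : src a = src b -> tgt a = tgt b -> a = b.
Proof. by move=> sE tE; apply: arc_eq_src; rewrite // /arc_edge sE tE. Qed.

Lemma rev_arcK : involutive rev_arc.
Proof. by move=> a; apply: arc_ext. Qed.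

Lemma src_neq_tgt a : src a != tgt a.
Proof. by apply/eqP => E; have := valP a; rewrite -/(src a) -/(tgt a) E adj_irr. Qed.

Lemma rev_arc_neq a : rev_arc a != a.
Proof. by apply/eqP => E; have := src_neq_tgt a; rewrite -{1}E src_rev eqxx. Qed.

Lemma arc_edge_eq a b : arc_edge a = arc_edge b -> a = b \/ a = rev_arc b.
Proof.
move=> E; have: src a \in arc_edge b by rewrite -E !inE eqxx.
rewrite !inE => /orP[] /eqP sE; [left|right]; apply: arc_eq_src => //.
by rewrite arc_edge_rev.
Qed.

Lemma arc_of_edge e : e \in edges G -> exists a, arc_edge a = e.
Proof. by case/imset2P => u v _ uv ->; exists (Sub (u, v) uv). Qed.

Definition rev_perm : {perm arc} := perm (inv_inj rev_arcK).

Lemma rev_permE a : rev_perm a = rev_arc a. Proof. exact: permE. Qed.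

Definition star_in (X : {set {set T}}) v := [set e in X | v \in e].

Lemma card_star_src (X : {set {set T}}) v : X \subset edges G ->
  #|[set a : arc | (arc_edge a \in X) && (src a == v)]| = #|star_in X v|.
Proof.
move=> XE; rewrite -(card_in_imset (f := @arc_edge T G)); last first.
  move=> a b; rewrite !inE => /andP[_ /eqP sa] /andP[_ /eqP sb].
  by apply: arc_eq_src; rewrite sa.
apply: eq_card => e; rewrite [RHS]inE; apply/imsetP/andP => [[a]|[eX ve]].
  by rewrite inE => /andP[aX /eqP <-] ->; rewrite !inE eqxx.
have [|a sa ea] := @incident_arc T G v e; first by rewrite !inE (subsetP XE).
by exists a; rewrite // inE ea eX sa eqxx.
Qed.

Lemma deg_src v : deg G v = #|[set a : arc | src a == v]|.
Proof.
rewrite -[LHS](card_star_src v (subxx _)); apply: eq_card => a; rewrite !inE.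
by case/andP: (arc_edge_incident a); rewrite inE => /andP[-> _].
Qed.

(** The port of an edge is one plus its distance along the rotation from a base arc chosen at the
    node; moving to the next port then amounts to applying [rho]. *)
Lemma rotation_port (rho : {perm arc}) :
    (forall a b, (src a == src b) = (a \in porbit rho b)) ->
  exists p : port_numbering G, forall a, rh_next p a = rho (rev_arc a).
Proof.
move=> rhoP.
have src_rho a : src (rho a) = src a by apply/eqP; rewrite rhoP porbit_mem1 porbit_id.
pose base v (a0 : arc) := odflt a0 [pick a | src a == v].
have src_base a : src (base (src a) a) = src a.
  by rewrite /base; case: pickP => [b /eqP|] //=.
have baseE a b : src a = src b -> base (src a) a = base (src a) b.
  by rewrite /base; case: pickP => [//|/(_ a)]; rewrite eqxx.
pose num a := findex rho (base (src a) a) a.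
have conn a b : src a = src b -> fconnect rho a b.
  move/eqP; rewrite eq_sym rhoP => /porbitP[i ->].
  by rewrite permX fconnect_iter.
have ordE a : fingraph.order rho (base (src a) a) = deg G (src a).
  rewrite deg_src; apply: eq_card => b; rewrite !inE.
  apply/idP/eqP => [|E]; last by apply: conn; rewrite src_base.
  by case/connectP => q; elim: q (base _ _) (src_base a) => [|c q IH] c0 s0 /=;
     [move=> _ -> | case/andP => /eqP cE; apply: IH; rewrite -cE src_rho].
have num_lt a : num a < deg G (src a).
  by rewrite -ordE findex_max // conn // src_base.
have iter_num a : iter (num a) rho (base (src a) a) = a.
  by rewrite iter_findex // conn // src_base.
pose port v (e : {set T}) :=
  if [pick a | (src a == v) && (arc_edge a == e)] is Some a then (num a).+1 else 0.
have portE a : port (src a) (arc_edge a) = (num a).+1.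
  rewrite /port; case: pickP => [b /andP[/eqP sb /eqP eb]|/(_ a)]; last by rewrite !eqxx.
  by rewrite (arc_eq_src sb eb).
have pinj v : {in incident G v &, injective (port v)}.
  move=> e f /incident_arc[a sa <-] /incident_arc[b sb <-].
  rewrite -{1}sa -sb !portE => -[E]; congr arc_edge.
  by rewrite -(iter_num a) -(iter_num b) E sb -sa (baseE a b) // sa.
have ponto v i : (i \in [seq port v e | e in incident G v]) = (1 <= i <= deg G v).
  apply/imageP/idP => [[e /incident_arc[a <- <-] ->]|]; first by rewrite portE num_lt.
  case: i => [//|i] /= lt; have: 0 < deg G v by lia.
  rewrite {1}deg_src => /card_gt0P[a0]; rewrite inE => /eqP sa.
  pose a := iter i rho (base (src a0) a0).
  have sav : src a = v.
    by rewrite /a; elim: {lt a} i => [|i IH] /=; rewrite ?src_base ?src_rho.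
  exists (arc_edge a); first by rewrite -sav; case/andP: (arc_edge_incident a).
  rewrite -{1}sav portE /num; congr _.+1.
  rewrite sav -sa -(baseE a0) ?sav // findex_iter //.
  by rewrite ordE sa.
exists (PortNumbering pinj ponto) => a.
set p := PortNumbering _ _; apply/eqP; rewrite -rh_succE /rh_succ src_rho src_rev eqxx /=.
have -> : tgt a = src (rev_arc a) by [].
move: (rev_arc a) (arc_edge_rev a) => {}a <-.
rewrite -[X in port X _ == _]src_rho !portE /next_port eqSS.
rewrite {1}/num src_rho -(baseE a) ?src_rho //.
move: (num_lt a) (ordE a) (iter_num a).
move: (num a) (base _ _) => i x0 lt oE iE; rewrite -{1}iE -iterS.
(* The last arc of the rotation returns to the base arc, which matches the wrap from port [deg] to
   port 1. *)
move: lt; rewrite leq_eqVlt => /orP[/eqP iS|lt].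
  by rewrite iS modnn -oE iter_order ?findex0 //; exact: perm_inj.
by rewrite modn_small // findex_iter ?oE.
Qed.

End Arcs.

(** * A cycle visiting all nodes *)

Section Witness.
Variables (T : finType) (G : sgraph T).
Local Notation arc := (sg_arc G).
Implicit Types (a b x y z : arc) (u v w : T) (rho : {perm arc}).

(** The face-tracing permutation of a rotation system: the arc is reversed, so that it leaves the
    node just entered, and then rotated. *)
Definition face_perm rho : {perm arc} := (rev_perm G * rho)%g.

Lemma face_permE rho a : face_perm rho a = rho (rev_arc a).
Proof. by rewrite permM rev_permE. Qed.

Variables (A : {set arc}).

(* The second condition says that [A] is a union of cycles of [face_perm rho]. *)
Definition routes rho :=
  [forall a, (src (rho a) == src a) && ((rho a \in A) == (rev_arc a \in A))].

Lemma routes_src rho a : routes rho -> src (rho a) = src a.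
Proof. by move/forallP/(_ a)/andP => [/eqP]. Qed.

Lemma routes_mem rho a : routes rho -> (rho a \in A) = (rev_arc a \in A).
Proof. by move/forallP/(_ a)/andP => [_ /eqP]. Qed.

Lemma routes_porbit_src rho a b : routes rho -> a \in porbit rho b -> src a = src b.
Proof.
move=> rt /porbitP[i ->]; elim: i => [|i IH]; first by rewrite expg0 perm1.
by rewrite expgSr permM routes_src.
Qed.

Lemma routes_face rho a b :
  routes rho -> b \in porbit (face_perm rho) a -> (b \in A) = (a \in A).
Proof.
move=> rt /porbitP[i ->]; elim: i => [|i IH]; first by rewrite expg0 perm1.
by rewrite expgSr permM face_permE routes_mem // rev_arcK.
Qed.

Lemma routes_mul (t : {perm arc}) rho :
  routes rho -> (forall a, src (t a) = src a) ->
  (forall a, (rev_arc (t a) \in A) = (rev_arc a \in A)) -> routes (t * rho)%g.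
Proof.
move=> rt st mt; apply/forallP => a.
by rewrite permM routes_src // st eqxx /= routes_mem // mt.
Qed.

Lemma routes_tperm rho a b :
  routes rho -> src a = src b -> (rev_arc a \in A) = (rev_arc b \in A) ->
  routes (tperm a b * rho)%g.
Proof.
by move=> rt sE mE; apply: routes_mul => // c; case: tpermP => // ->.
Qed.

Definition mixed v := [exists z, (src z == v) && ((z \in A) != (rev_arc z \in A))].
Definition saturated v :=
  [forall z, (src z == v) ==> ((z \in A) && (rev_arc z \in A))].

(** By minimality, arcs at one node whose reverses agree on [A] share an orbit. A second orbit would
    then separate arcs with reverse in [A] from the others; since [rho] preserves orbits, an arc
    would be in [A] exactly when its reverse is, and the node would be neither mixed nor
    saturated. *)
Lemma routes_min_cyclic rho :
    (forall v, mixed v || saturated v) -> routes rho ->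
    (forall rho', routes rho' -> #|porbits rho| <= #|porbits rho'|) ->
  forall a b, (src a == src b) = (a \in porbit rho b).
Proof.
move=> cond rt rmin a b; apply/eqP/idP; last exact: routes_porbit_src.
move=> sab; apply/idPn => nab.
have same c d : src c = src d -> (rev_arc c \in A) = (rev_arc d \in A) ->
    c \in porbit rho d.
  move=> sE mE; apply/idPn => ncd.
  by have := card_porbits_merge ncd; rewrite ltnNge rmin // routes_tperm.
wlog [ia ib] : a b sab nab / (rev_arc a \in A) /\ (rev_arc b \notin A).
  move=> H; case: (boolP (rev_arc a \in A)) (boolP (rev_arc b \in A)) => ma [] mb.
  - by case/negP: nab; apply: same; rewrite // ma mb.
  - exact: (H a b).
  - by apply: (H b a) => //; rewrite porbit_sym.
  - by case/negP: nab; apply: same; rewrite // (negbTE ma) (negbTE mb).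
have memE c : src c = src b -> (rev_arc c \in A) = (c \in porbit rho a).
  move=> sc; apply/idP/idP => [ic|ca].
    by apply: same; rewrite ?sc ?ic ?ia.
  apply/idPn => nc; case/negP: nab.
  have: c \in porbit rho b by apply: same; rewrite ?sc // (negbTE nc) (negbTE ib).
  by rewrite -eq_porbit_mem => /eqP <-; rewrite porbit_sym.
have unmixed c : src c = src b -> (c \in A) = (rev_arc c \in A).
  move=> sc; have sc' : src (rho^-1 c)%g = src b by rewrite -sc -(routes_src _ rt) permKV.
  by rewrite -{1}(permKV rho c) routes_mem // !memE // porbit_memV.
case/orP: (cond (src b)) => [/existsP[c /andP[/eqP sc]]|/forallP/(_ b)].
  by rewrite (unmixed _ sc) eqxx.
by rewrite eqxx (negbTE ib) andbF.
Qed.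

Lemma face_visits_all rho0 :
    (forall v, mixed v || saturated v) ->
    (forall S : {set T}, S != set0 -> S != setT -> exists a,
       [/\ src a \in S, tgt a \notin S, a \in A & rev_arc a \in A]) ->
    2 <= #|T| -> routes rho0 ->
  exists rho a0, [/\ forall a b, (src a == src b) = (a \in porbit rho b),
    porbit (face_perm rho) a0 \subset A
    & forall v, exists2 a, a \in porbit (face_perm rho) a0 & tgt a = v].
Proof.
move=> cond conn T2 rt0.
have [rho1 rt1 min1] := arg_minnP (fun rho => #|porbits rho|) rt0.
have [a1 a1A] : exists a, a \in A.
  have /card_gt0P[v _] : 0 < #|T| by lia.
  have [||a [_ _ aA _]] := conn [set v]; last by exists a.
    by apply/set0Pn; exists v; rewrite inE.
  by apply/eqP => E; have := cardsT T; rewrite -E cards1; lia.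
(* The face is maximised only over rotations with the fewest orbits, since these are cyclic at every
   node. *)
pose P (f : {perm arc} * arc) :=
  [&& routes f.1, #|porbits f.1| <= #|porbits rho1| & f.2 \in A].
have P1 : P (rho1, a1) by rewrite /P rt1 leqnn a1A.
have [[rho a0] /and3P[/= rt cardr a0A] max] :=
  arg_maxnP (fun f => #|porbit (face_perm f.1) f.2|) P1.
have cyc : forall a b, (src a == src b) = (a \in porbit rho b).
  by apply: routes_min_cyclic => // r rr; apply: leq_trans cardr (min1 _ rr).
set F := porbit (face_perm rho) a0 in max *.
have FA : F \subset A by apply/subsetP => b /(routes_face rt) ->.
exists rho, a0; split=> //; rewrite -/F.
pose S := [set tgt a | a in F].
suff S1 : S = setT.
  move=> v; have: v \in S by rewrite S1 inE.
  by case/imsetP => a aF ->; exists a.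
apply/eqP/idPn => S1; have S0 : S != set0.
  by apply/set0Pn; exists (tgt a0); apply: imset_f; exact: porbit_id.
(* The arc [uv] leaves the visited nodes at the end of [a]. Its reverse [c] and its predecessor [b]
   end there too, and both lie off [F], since otherwise [F] would visit [tgt uv]. *)
have [uv [/imsetP[a aF ua] vS uvA vuA]] := conn S S0 S1.
have FE : F = porbit (face_perm rho) a by apply/eqP; rewrite eq_sym eq_porbit_mem.
have aA : a \in A by apply: (subsetP FA).
set c := rev_arc uv in vuA.
have cF : c \notin F.
  apply: contra vS => cF; rewrite -[tgt uv]/(src c).
  suff -> : src c = tgt ((face_perm rho)^-1 c)%g by apply: imset_f; rewrite porbit_memV.
  by rewrite -[RHS]src_rev -[RHS](routes_src _ rt) -face_permE permKV.
pose b := ((face_perm rho)^-1)%g uv.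
have bE : rho (rev_arc b) = uv by rewrite -face_permE permKV.
have bF : b \notin F.
  rewrite porbit_memV; apply: contra vS => ?; exact: imset_f.
have tb : tgt b = tgt a by rewrite -ua -bE routes_src.
have tc : tgt c = tgt a by rewrite -ua.
have bA : b \in A by rewrite -(rev_arcK b) -(routes_mem _ rt) bE.
have ab : a != b by apply: contra bF => /eqP <-.
have ac : a != c by apply: contra cF => /eqP <-.
(* If [b = c], the rotation fixes [uv]; then [uv] is the only arc leaving its source, which forces
   [a = c]. *)
have bc : b != c.
  apply: contra ac => /eqP bc; rewrite bc rev_arcK in bE.
  have: rev_arc a \in porbit rho uv by rewrite -cyc src_rev ua.
  case/porbitP => i aE; have {}aE : rev_arc a = uv.
    by rewrite aE; elim: (i) => [|j IH]; rewrite ?expg0 ?perm1 // expgSr permM IH.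
  by rewrite /c -aE rev_arcK.
(* After [t], the arc [a] is followed by the old successor of [b] or of [c], which is off [F], while
   the other arcs of [F] keep their successors. So the face of [a] grows. *)
have [t [tcard ta th tid]] : exists t, [/\ #|porbits (t * rho)%g| = #|porbits rho|,
    t (rev_arc a) != rev_arc a,
    {homo t : z / z \in [:: rev_arc a; rev_arc b; rev_arc c]}
    & forall z, z \notin [:: rev_arc a; rev_arc b; rev_arc c] -> t z = z].
  apply: porbits_mul_cycle3; rewrite ?(inj_eq (inv_inj (@rev_arcK T G))) //.
  by rewrite -cyc !src_rev tb.
have in3 (Q : arc -> Prop) z : Q (rev_arc a) -> Q (rev_arc b) -> Q (rev_arc c) ->
    z \in [:: rev_arc a; rev_arc b; rev_arc c] -> Q z.
  by move=> ? ? ?; rewrite !inE => /or3P[] /eqP->.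
have in3s : forall z, z \in [:: rev_arc a; rev_arc b; rev_arc c] -> src z = tgt a.
  by move=> z; apply: (in3 (fun z => src z = tgt a)).

have in3m : forall z, z \in [:: rev_arc a; rev_arc b; rev_arc c] -> rev_arc z \in A.
  by move=> z; apply: (in3 (fun z => rev_arc z \in A)); rewrite rev_arcK.
have rt' : routes (t * rho)%g.
  apply: routes_mul => // w;
    have [w3|nw3] := boolP (w \in [:: rev_arc a; rev_arc b; rev_arc c]).
  - by rewrite !in3s // th.
  - by rewrite tid.
  - by rewrite !in3m // th.
  - by rewrite tid.
have := max (t * rho, a)%g; rewrite /P /= rt' tcard cardr aA => /(_ isT).
rewrite leqNgt FE => /negP; apply; apply: proper_card.
apply: porbit_proper => [z zF za|].
  rewrite !face_permE permM tid // !inE !(inj_eq (inv_inj (@rev_arcK T G))).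
  rewrite -FE in zF; rewrite !negb_or za /=.
  by apply/andP; split; apply: contraTneq zF => ->.
rewrite face_permE permM -FE.
have := th (rev_arc a); rewrite !inE eqxx (negbTE ta) /= => /(_ isT).
by case/orP => /eqP ->; rewrite -face_permE porbit_mem1.
Qed.

End Witness.

(** * Even edge sets *)

Section Symdiff.
Variable I : finType.
Implicit Types A B C : {set I}.

Definition symdiff A B := (A :\: B) :|: (B :\: A).

Lemma in_symdiff A B x : (x \in symdiff A B) = (x \in A) (+) (x \in B).
Proof. by rewrite !inE; case: (x \in A); case: (x \in B). Qed.

Lemma odd_card_symdiff A B : odd #|symdiff A B| = odd #|A| (+) odd #|B|.
Proof.
have -> : #|symdiff A B| = #|A :\: B| + #|B :\: A|.
  rewrite cardsU; have -> : (A :\: B) :&: (B :\: A) = set0.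
    by apply/setP => x; rewrite !inE; case: (x \in A); case: (x \in B).
  by rewrite cards0 subn0.
rewrite -(cardsID B A) -(cardsID A B) [B :&: A]setIC !oddD.
by case: (odd _); case: (odd _); case: (odd _).
Qed.

End Symdiff.

Section EdgeSets.
Variables (T : finType) (G : sgraph T).
Implicit Types (X Y C D H : {set {set T}}) (u v w r : T) (e : {set T}).

Definition even_edges X := [forall v, ~~ odd #|star_in X v|].

Lemma star_in_symdiff X Y v :
  star_in (symdiff X Y) v = symdiff (star_in X v) (star_in Y v).
Proof.
by apply/setP => e; rewrite in_symdiff ![e \in star_in _ _]in_set in_symdiff andb_addl.
Qed.

Lemma even_symdiff X Y : even_edges X -> even_edges Y -> even_edges (symdiff X Y).
Proof.
move=> /forallP eX /forallP eY; apply/forallP => v.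
by rewrite star_in_symdiff odd_card_symdiff (negbTE (eX v)) (negbTE (eY v)).
Qed.

Lemma even_edges0 : even_edges set0.
Proof.
apply/forallP => v; have -> : star_in set0 v = set0 by apply/setP => e; rewrite !inE.
by rewrite cards0.
Qed.

Lemma handshake X : X \subset edges G -> \sum_v #|star_in X v| = 2 * #|X|.
Proof.
move=> XE; have -> : \sum_v #|star_in X v| = \sum_v \sum_(e in X) (v \in e).
  apply: eq_bigr => v _; rewrite -sum1_card big_mkcond [RHS]big_mkcond /=.
  by apply: eq_bigr => e _; rewrite inE; case: (e \in X) => //=; case: (v \in e).
rewrite exchange_big /= mulnC -sum_nat_const; apply: eq_bigr => e eX.
have [a <-] := arc_of_edge (subsetP XE _ eX).
have -> : 2 = #|arc_edge a| by rewrite cards2 src_neq_tgt.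
rewrite -sum1_card [RHS]big_mkcond /=.
by apply: eq_bigr => v _; case: (v \in _).
Qed.

(* There are [2 ^ #|X|] subsets of [X], but only [2 ^ (#|T| - 1)] possible sets
   of odd nodes other than [r]; the parity at [r] follows from the others. *)
Lemma exists_even X : X \subset edges G -> 0 < #|T| <= #|X| ->
  exists C, [/\ C \subset X, C != set0 & even_edges C].
Proof.
move=> XE /andP[/card_gt0P[r _] TX].
pose f Y := [set v | odd #|star_in Y v|] :\ r.
have /dinjectivePn[Y YX [Z]] : ~~ dinjectiveb f (mem (powerset X)).
  apply/negP => /dinjectiveP fi.
  have : #|f @: powerset X| <= #|powerset (setT :\ r)|.
    apply/subset_leq_card/subsetP => _ /imsetP[Y _ ->].
    by rewrite inE; apply/subsetP => v; rewrite !inE andbT => /andP[].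
  rewrite card_in_imset // !card_powerset leq_exp2l //.
  have := cardsD1 r [set: T]; rewrite cardsT inE; lia.
rewrite !inE => /andP[ZY ZX] fE; rewrite inE in YX.
exists (symdiff Y Z); split.
- by rewrite subUset !(subset_trans (subsetDl _ _)).
- apply: contraNneq ZY => /setP E; apply/eqP/setP => e.
  by have := E e; rewrite in_symdiff inE; case: (e \in Y); case: (e \in Z).
have CE : symdiff Y Z \subset edges G.
  by rewrite subUset !(subset_trans (subsetDl _ _)) ?(subset_trans _ XE).
have ev v : v != r -> ~~ odd #|star_in (symdiff Y Z) v|.
  move=> vr; rewrite star_in_symdiff odd_card_symdiff.
  by move/setP/(_ v): fE; rewrite !inE vr /= => ->; rewrite addbb.
apply/forallP => v; have [->|] := eqVneq v r; last exact: ev.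
have rest : ~~ odd (\sum_(u | u != r) #|star_in (symdiff Y Z) u|).
  elim/big_ind: _ => // a b; rewrite oddD => /negbTE-> /negbTE->//.
have := handshake CE; rewrite (bigD1 r) //= => /(congr1 odd).
by rewrite mul2n odd_double oddD (negbTE rest) addbF => ->.
Qed.

Lemma even_max_cover H : exists D, [/\ D \subset H, even_edges D
  & forall D', D' \subset H -> even_edges D' -> cover D \subset cover D' ->
      cover D = cover D' /\ #|D| <= #|D'|].
Proof.
pose P D := (D \subset H) && even_edges D.
have P0 : P set0 by rewrite /P sub0set even_edges0.
(* As [M] exceeds every cardinality, the weight below orders sets first by nodes covered, then by
   fewest edges. *)
have [M ltM] : exists M, forall X : {set {set T}}, #|X| < M.
  by exists #|{: {set T}}|.+1 => X; rewrite ltnS max_card.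
have [D /andP[DH eD] max] := arg_maxnP (fun D => #|cover D| * M + (M - #|D|)) P0.
exists D; split=> // D' D'H eD' sub.
have := max D'; rewrite /P D'H eD' => /(_ isT).
have lt := ltM D; have lt' := ltM D'; have cl := subset_leq_card sub => le.
have E : #|cover D| = #|cover D'| by nia.
split; first by apply/eqP; rewrite eqEcard sub E leqnn.
by move: le => /=; rewrite E leq_add2l leq_sub2lE // ltnW.
Qed.

End EdgeSets.

(** * Closed trails *)

(** In a list of each fiber, position 0 is paired with 1, 2 with 3, and so on; the even size keeps
    every partner in range. Points off [S] are fixed. *)
Lemma fiber_pairing (D I : finType) (S : {set D}) (f : D -> I) :
    (forall i, ~~ odd #|[set x in S | f x == i]|) ->
  exists g : D -> D, [/\ involutive g, forall x, f (g x) = f x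
    & forall x, (g x == x) = (x \notin S)].
Proof.
move=> ev; pose sib i := if odd i then i.-1 else i.+1.
have sibK : involutive sib.
  move=> i; rewrite /sib; case oi: (odd i); case: i oi => //= i.
    by move/negbTE->.
  by move->.
have sib_neq i : sib i != i by rewrite /sib; case oi: (odd i); lia.
have sib_lt i n : ~~ odd n -> i < n -> sib i < n.
  move=> on lt; rewrite /sib; case oi: (odd i); first lia.
  rewrite ltn_neqAle lt andbT; apply: contraNneq on => <-.
  by rewrite /= oi.
pose fib x := enum [set y in S | f y == f x].
pose g x := if x \in S then nth x (fib x) (sib (index x (fib x))) else x.
have fib_eq x y : f x = f y -> fib x = fib y by rewrite /fib => ->.
have mem_fib x y : (y \in fib x) = (y \in S) && (f y == f x) by rewrite mem_enum inE.
have lt_fib x : x \in S -> sib (index x (fib x)) < size (fib x).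
  move=> xS; apply: sib_lt; first by rewrite -cardE ev.
  by rewrite index_mem mem_fib xS eqxx.
have g_fib x : x \in S -> g x \in fib x.
  by move=> xS; rewrite /g xS mem_nth ?lt_fib.
have gS x : x \in S -> g x \in S.
  by move=> xS; have := g_fib x xS; rewrite mem_fib => /andP[].
have fg x : f (g x) = f x.
  have [xS|xS] := boolP (x \in S); last by rewrite /g (negbTE xS).
  by have := g_fib x xS; rewrite mem_fib => /andP[_ /eqP].
have index_g x : x \in S -> index (g x) (fib x) = sib (index x (fib x)).
  by move=> xS; rewrite /g xS index_uniq ?enum_uniq ?lt_fib.
exists g; split=> // x.
- have [xS|xS] := boolP (x \in S); last by rewrite /g (negbTE xS) (negbTE xS).
  rewrite {1}/g gS // (fib_eq _ x (fg x)) index_g // sibK.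
  by rewrite nth_index // mem_fib xS eqxx.
- have [xS|xS] := boolP (x \in S); last by rewrite /g (negbTE xS) eqxx.
  by apply: contraNF (sib_neq (index x (fib x))) => /eqP gx; rewrite -index_g // gx.
Qed.

Section Orientation.
Variables (T : finType) (G : sgraph T).
Local Notation arc := (sg_arc G).
Implicit Types (a b x y z : arc) (u v w : T).

(* Pairing the edges of [D] at each node decomposes [D] into closed trails; the
   permutation [rev_arc] then [g] follows them, each in both directions, and
   [O] keeps one direction of each. *)
Lemma even_orientation (D : {set {set T}}) :
    D \subset edges G -> (forall v, ~~ odd #|star_in D v|) ->
  exists (g : {perm arc}) (O : {set arc}), [/\ forall a, src (g a) = src a,
    forall a, if arc_edge a \in D then arc_edge (g a) \in D else g a == a,
    forall a, (arc_edge a \in D) = (a \in O) || (rev_arc a \in O),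
    forall a, a \in O -> rev_arc a \notin O
    & forall a, (g a \in O) = (rev_arc a \in O)].
Proof.
move=> DE ev; pose S := [set a : arc | arc_edge a \in D].
have [|g0 [g0K src_g0 fix_g0]] := @fiber_pairing arc T S (@src T G).
  move=> v; have := ev v; rewrite -(card_star_src v DE); congr (~~ odd _).
  by apply: eq_card => a; rewrite !inE.
pose g := perm (inv_inj g0K).
have gK : involutive g by move=> a; rewrite !permE.
have src_g a : src (g a) = src a by rewrite permE.
have fix_g a : (g a == a) = (a \notin S) by rewrite permE fix_g0.
have revS a : (rev_arc a \in S) = (a \in S) by rewrite !inE arc_edge_rev.
have gS a : (g a \in S) = (a \in S).
  by apply/negb_inj; rewrite -!fix_g gK eq_sym.
pose phi := (rev_perm G * g)%g.
have phiE a : phi a = g (rev_arc a) by rewrite permM rev_permE.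
have phi_rev a : phi (rev_arc (phi a)) = rev_arc a by rewrite !phiE rev_arcK gK.
(* No trail runs through an arc in both directions: if [k + 2] steps lead from [a] to its reverse,
   then [k] steps lead from [phi a] to its own reverse. The cases 0 and 1 would give a fixed point
   of [rev_arc] or of [g]. *)
have apart a : a \in S -> rev_arc a \notin porbit phi a.
  move=> aS; apply/negP => /porbitP[k]; elim/ltn_ind: k a aS => -[|[|k]] IH a aS.
  - by rewrite expg0 perm1 => /eqP; rewrite (negbTE (rev_arc_neq a)).
  - by rewrite expg1 phiE => /esym/eqP; rewrite fix_g revS aS.
  rewrite -phi_rev expgSr [X in _ = X -> _]permM => /perm_inj.
  rewrite expgS [X in _ = X -> _]permM; apply: IH => //.
  by rewrite phiE gS revS.
(* Opposite trails are different orbits; comparing their ranks selects one of the two consistently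
   along the trail. *)
pose rk a := enum_rank (porbit phi a) : nat.
have rk_neq a : a \in S -> rk a != rk (rev_arc a).
  move=> aS; apply: contra (apart a aS) => /eqP/ord_inj/enum_rank_inj ->.
  exact: porbit_id.
have rk_phi a : rk (phi a) = rk a.
  by rewrite /rk -(porbit_perm phi 1 a) expg1.
pose O := [set a in S | rk a < rk (rev_arc a)].
exists g, O; split=> // a.
- case: ifP => aD; first by have := gS a; rewrite !inE aD.
  by rewrite fix_g inE aD.
- rewrite ![_ \in O]inE revS rev_arcK -andb_orr -neq_ltn [_ \in S]inE.
  by case aD: (_ \in D) => //=; rewrite rk_neq // inE.
- by rewrite !inE !negb_and rev_arcK -leqNgt => /andP[_ /ltnW ->]; rewrite orbT.
have -> : g a = phi (rev_arc a) by rewrite phiE rev_arcK.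
rewrite [LHS]inE [RHS]inE rk_phi rev_arcK phiE rev_arcK gS revS.
by rewrite -(rk_phi (rev_arc (g a))) phiE rev_arcK gK.
Qed.

(** Every arc off [O] is an orbit by itself; the other orbits are closed directed trails
    partitioning [O]. Minimising the number of orbits therefore minimises the number of trails. *)
Definition follows (O : {set arc}) (s : {perm arc}) :=
  [forall a, if a \in O then src (s a) == tgt a else s a == a].

Lemma follows_src O s a : follows O s -> a \in O -> src (s a) = tgt a.
Proof. by move/forallP/(_ a) => + aO; rewrite aO => /eqP. Qed.

Lemma follows_mem O s a : follows O s -> (s a \in O) = (a \in O).
Proof.
move=> fs; have fixN b : b \notin O -> s b = b.
  by move/negbTE => bO; move/forallP/(_ b): fs; rewrite bO => /eqP.
have [aO|aO] := boolP (a \in O); last by rewrite fixN // (negbTE aO).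
by apply/idPn => sN; have /perm_inj E := fixN _ sN; rewrite E aO in sN.
Qed.

(* With the fewest closed trails, distinct trails are node-disjoint, and each
   one has at least three nodes; [N] takes every other arc of each trail. *)
Lemma alternating_arcs (O : {set arc}) (s0 : {perm arc}) :
    (forall a, a \in O -> rev_arc a \notin O) -> follows O s0 ->
  exists s (N : {set arc}), [/\ follows O s, N \subset O,
    forall a, a \in O -> (a \in N) || (s a \in N)
    & 6 * #|N| <= 3 * #|O| + #|T|].
Proof.
move=> anti fs0.
have [s fs smin] := arg_minnP (fun s : {perm arc} => #|porbits s|) fs0.
(* Two trails entering a common node could be joined by exchanging their continuations. *)
have meet a b : a \in O -> b \in O -> tgt a = tgt b -> fconnect s a b.
  move=> aO bO tE; rewrite -fconnect_porbit; apply/idPn => ab.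
  have := card_porbits_merge ab; rewrite ltnNge smin //.
  apply/forallP => c; rewrite permM.
  case: tpermP => [->|->|_ _]; rewrite ?aO ?bO; last exact: (forallP fs c).
    by rewrite (follows_src fs aO) tE.
  by rewrite (follows_src fs bO) tE.
have csym := fconnect_sym (@perm_inj _ s).
have frS a : froot s (s a) = froot s a by apply/esym/(fingraph.rootP csym)/fconnect1.
(* The position of [a] on its trail, counted from the root; [N] takes the even positions and [R] has
   one arc per trail. *)
pose ix a := findex s (froot s a) a.
have ixE a : iter (ix a) s (froot s a) = a by rewrite iter_findex // csym connect_root.
have ixS a : ix (s a) != 0 -> ix (s a) = (ix a).+1.
  have ltix : ix a < fingraph.order s (froot s a).
    by rewrite findex_max // csym connect_root.
  rewrite {1 2}/ix frS; move: ltix (ixE a); move: (ix a) (froot s a) => i x0 + iE.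
  rewrite -iE -iterS leq_eqVlt => /orP[/eqP->|lt _].
    by rewrite iter_order ?findex0 //; exact: perm_inj.
  by rewrite findex_iter.
pose N := [set a in O | ~~ odd (ix a)].
pose R := [set a in O | ix a == 0].
have RN : R \subset N by apply/subsetP => a; rewrite !inE => /andP[-> /eqP->].
(* The first three arcs of a trail start at distinct nodes, and different trails share no node. *)
have card_R : #|R| * 3 <= #|T|.
  have -> : #|R| * 3 = #|setX R [set: 'I_3]| by rewrite cardsX cardsT card_ord.
  have frV a : froot s ((s^-1)%g a) = froot s a by rewrite -{2}(permKV s a) frS.
  have frI i a : froot s (iter i s a) = froot s a.
    by elim: i => //= i IH; rewrite frS.
  have memI i a : (iter i s a \in O) = (a \in O).
    by elim: i => //= i IH; rewrite follows_mem.
  pose h (q : arc * 'I_3) := src (iter q.2 s q.1).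
  rewrite -(card_in_imset (f := h)) ?max_card // => -[a i] [b j].
  rewrite !inE !andbT /= => /andP[aO /eqP ra] /andP[bO /eqP rb]; rewrite /h /= => E.
  have root0 c : ix c = 0 -> froot s c = c.
    by move/eqP; rewrite findex_eq0 => /eqP.
  have tgtV c : c \in O -> tgt ((s^-1)%g c) = src c /\ (s^-1)%g c \in O.
    move=> cO; have vO : (s^-1)%g c \in O by rewrite -(follows_mem _ fs) permKV.
    by rewrite -(follows_src fs vO) permKV.
  have ab : a = b.
    have iO : iter i s a \in O by rewrite memI.
    have jO : iter j s b \in O by rewrite memI.
    have [ti vi] := tgtV _ iO; have [tj vj] := tgtV _ jO.
    have /(fingraph.rootP csym) :
        fconnect s ((s^-1)%g (iter i s a)) ((s^-1)%g (iter j s b)).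
      by apply: meet; rewrite ?ti ?tj.
    by rewrite !frV !frI !root0.
  rewrite -ab in E *; congr pair; clear ab b bO rb.
  have sO : s a \in O by rewrite follows_mem.
  have n01 : src a <> src (s a).
    by rewrite (follows_src fs aO); apply/eqP/src_neq_tgt.
  have n12 : src (s a) <> src (s (s a)).
    by rewrite (follows_src fs sO); apply/eqP/src_neq_tgt.
  (* Otherwise [s a] would be the reverse of [a], but [O] never contains both directions of an
     edge. *)
  have n02 : src a <> src (s (s a)).
    rewrite (follows_src fs sO) => E02; have /negP := anti _ aO; case.
    rewrite (_ : rev_arc a = s a) //; apply: arc_ext => //.
    by rewrite (follows_src fs aO).
  apply: ord_inj; move: E; case: i => -[|[|[|//]]] ?; case: j => -[|[|[|//]]] ? //=;
  by first [move=> /n01 | move=> /n02 | move=> /n12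
    | move=> /esym/n01 | move=> /esym/n02 | move=> /esym/n12].
exists s, N; split=> //.
- by apply/subsetP => a; rewrite inE => /andP[].
- move=> a aO; rewrite !inE follows_mem // aO /=.
  have [->|/ixS->] := eqVneq (ix (s a)) 0; first by rewrite orbT.
  by rewrite /= negbK orNb.
(* Each arc at a positive even position is preceded by one at an odd position, whence
   [2|N| <= |O| + |R|]. *)
have shift : #|N :\: R| <= #|O :\: N|.
  rewrite -(card_imset _ (@perm_inj _ (s^-1)%g)); apply/subset_leq_card/subsetP.
  move=> _ /imsetP[a aNR ->]; set b := (s^-1)%g a.
  move: aNR; have -> : a = s b by rewrite permKV.
  rewrite !inE follows_mem //; case: (b \in O) => //= /andP[/ixS -> /=].
  by rewrite negbK andbT.
have := cardsID R N; have := cardsID N O.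
rewrite (setIidPr RN) (setIidPr (_ : N \subset O)); last first.
  by apply/subsetP => a; rewrite inE => /andP[].
lia.
Qed.

End Orientation.

(** * The short witness cycle *)

Section Assembly.
Variables (T : finType) (G : sgraph T).
Local Notation arc := (sg_arc G).
Implicit Types (a b x y z : arc) (u v w : T) (S : {set T}).

Lemma connect_crossing (B : {set {set T}}) S r v :
    connect (fun u w => [set u; w] \in B) r v -> r \in S -> v \notin S ->
  exists u w, [/\ u \in S, w \notin S & [set u; w] \in B].
Proof.
case/connectP => q; elim: q r => [|w q IH] r /=; first by move=> _ -> ->.
case/andP=> rw pq lq rS vS; have [wS|wS] := boolP (w \in S); first exact: IH lq wS vS.
by exists r, w.
Qed.

(** The tree grows from a root by edges leaving the set of nodes reached so far; each added edge is
    paid for by a new node. *)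
Lemma spanning_tree : sg_connected G -> 0 < #|T| ->
  exists B : {set {set T}}, [/\ B \subset edges G, #|B| < #|T|
    & forall u v, connect (fun u w => [set u; w] \in B) u v].
Proof.
move=> conn /card_gt0P[r _].
suff [B [BE cB rB]] : exists B : {set {set T}}, [/\ B \subset edges G, #|B| < #|T|
    & forall v, connect (fun u w => [set u; w] \in B) r v].
  exists B; split=> // u v; apply: connect_trans (rB v).
  by rewrite sym_connect_sym // => x y; rewrite setUC.
suff H k : k < #|T| ->
    exists (B : {set {set T}}) S, [/\ B \subset edges G, #|B| <= k, k < #|S|
    & forall v, v \in S -> connect (fun u w => [set u; w] \in B) r v].
  have T0 : 0 < #|T| by apply/card_gt0P; exists r.
  have [|B [S [BE cB cS rB]]] := H #|T|.-1; first by rewrite ltn_predL.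
  rewrite prednK // in cS; have ST : S = setT.
    by apply/eqP; rewrite eqEcard subsetT cardsT.
  by exists B; split=> // [|v]; [rewrite -(prednK T0) | rewrite rB // ST inE].
elim: k => [_|k IH kT].
  exists set0, [set r]; rewrite sub0set cards0 cards1; split=> // v.
  by rewrite inE => /eqP->.
have [|B [S [BE cB cS rB]]] := IH; first exact: ltnW.
have [ST|ST] := boolP (S == setT).
  exists B, S; split=> //; first exact: leqW.
  by rewrite (eqP ST) cardsT.
have [v vS] : exists v, v \notin S.
  by move: ST; rewrite -properT => /properP[_ [v _ vS]]; exists v.
have [s sS] : exists s, s \in S by apply/set0Pn; rewrite -card_gt0; case: #|S| cS.
have [|u [w [uS wS uw]]] := @connect_crossing (edges G) S s v _ sS vS.
  apply: connect_sub (conn s v) => x y xy; apply: connect1.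
  by apply: imset2_f.
exists ([set u; w] |: B), (w |: S); split.
- by rewrite subUset sub1set uw.
- by rewrite cardsU1; case: (_ \notin _); lia.
- by rewrite cardsU1 wS.
have mono (x : T) : connect (fun u w => [set u; w] \in B) r x ->
    connect (fun x y : T => [set x; y] \in [set u; w] |: B) r x.
  by apply: connect_sub => y z yz; apply: connect1; rewrite inE yz orbT.
move=> x; rewrite in_setU1 => /predU1P[->|/rB]; last exact: mono.
apply: connect_trans (mono _ (rB _ uS)) _.
by apply: connect1; rewrite in_setU1 eqxx.
Qed.

Lemma card_arcs (B : {set {set T}}) : B \subset edges G ->
  #|[set a : arc | arc_edge a \in B]| = 2 * #|B|.
Proof.
move=> BE; rewrite -(handshake BE) -sum1_card (partition_big (@src T G) xpredT) //=.
apply: eq_bigr => v _; rewrite -[RHS](card_star_src v BE) -sum1_card.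
by apply: eq_bigl => a; rewrite !inE.
Qed.

Lemma balanced_arcs : sg_connected G -> 2 <= #|T| ->
  exists (A : {set arc}) (rho : {perm arc}), [/\ routes A rho,
    forall v, mixed A v || saturated A v,
    forall S, S != set0 -> S != setT -> exists a,
      [/\ src a \in S, tgt a \notin S, a \in A & rev_arc a \in A]
    & 3 * #|A| + 12 <= 13 * #|T|].
Proof.
move=> conn T2; have T0 : 0 < #|T| by lia.
have [B [BE cB connB]] := spanning_tree conn T0.
have [D [DH eD maxD]] := even_max_cover (edges G :\: B).
have DE : D \subset edges G := subset_trans DH (subsetDl _ _).
have [g [O [src_g gD DO antiO gO]]] := even_orientation DE (forallP eD).
have fix_g a : arc_edge a \notin D -> g a = a by have := gD a; case: ifP => // _ /eqP.
have revE a b : arc_edge a = arc_edge b -> a \in O -> b \in O -> a = b.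
  move=> E aO bO; case: (arc_edge_eq E) => // aE.
  by have := antiO _ bO; rewrite -aE aO.
(* Following the pairing [g] along [O] gives a first decomposition into closed trails. *)
have phi_inj : injective (fun a => if a \in O then g (rev_arc a) else a).
  have phiO a : a \in O -> g (rev_arc a) \in O by rewrite gO rev_arcK.
  move=> a b; case: ifP => aO; case: ifP => bO //.
  - by move/perm_inj/(inv_inj (@rev_arcK T G)).
  - by move=> E; rewrite -E phiO in bO.
  - by move=> E; rewrite E phiO in aO.
have [|s [N [fs NO altN cN]]] := @alternating_arcs T G O (perm phi_inj) antiO.
  by apply/forallP => a; case aO: (a \in O); rewrite permE aO ?src_g.
pose W := [set e in edges G :\: B | ~~ (e \subset cover D)].
have WE : W \subset edges G by apply/subsetP => e; rewrite !inE => /andP[/andP[]].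
have DW : [disjoint D & W].
  rewrite disjoint_subset; apply/subsetP => e eD'.
  by rewrite !inE negb_and negbK bigcup_sup ?orbT.
have coverO v : v \in cover D ->
    exists a, [/\ a \in O, tgt a = v & (a \in N) || (s a \in N)].
  case/bigcupP => e eD' ve.
  have [a aO ae] : exists2 a, a \in O & arc_edge a = e.
    have [a ae] := arc_of_edge (subsetP DE _ eD'); have := DO a; rewrite ae eD'.
    by case/esym/orP=> ?; [exists a | exists (rev_arc a); rewrite ?arc_edge_rev].
  move: ve; rewrite -ae !inE => /orP[] /eqP ->; last by exists a; rewrite altN.
  have vO : (s^-1)%g a \in O by rewrite -(follows_mem _ fs) permKV.
  by exists ((s^-1)%g a); rewrite altN // -(follows_src fs vO) permKV.
have OD a : a \in O -> arc_edge a \in D by rewrite DO => ->.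
pose X := W :|: (D :\: [set arc_edge a | a in N]).
(* Otherwise [X] contains a nonempty even set [C]. Each node covered by [D] lies on an edge of [N],
   which is in [D] and avoids [C], so [symdiff D C] still covers it. *)
have cX : #|X| < #|T|.
  rewrite ltnNge; apply/negP => TX.
  have [||C [CX C0 eC]] := @exists_even T G X; rewrite ?T0 //.
    by rewrite subUset WE (subset_trans (subsetDl _ _)).
  have DC v : v \in cover D -> exists2 e, e \in D & (e \notin C) && (v \in e).
    case/coverO => a [aO <- aN].
    have [b bN vb] : exists2 b, b \in N & tgt a \in arc_edge b.
      case/orP: aN => ?; [exists a | exists (s a)]; rewrite // !inE ?eqxx ?orbT //.
      by rewrite (follows_src fs) ?eqxx.
    have bD : arc_edge b \in D by apply: OD; apply: (subsetP NO).
    exists (arc_edge b) => //; rewrite vb andbT; apply/negP => /(subsetP CX).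
    rewrite in_setU (disjointFr DW bD) /= in_setD (imset_f (@arc_edge T G) bN).
    by [].
  have D'H : symdiff D C \subset edges G :\: B.
    rewrite subUset (subset_trans (subsetDl _ _) DH) (subset_trans (subsetDl _ _)) //.
    apply: subset_trans CX _; rewrite subUset (subset_trans (subsetDl _ _) DH) andbT.
    by apply/subsetP => e; rewrite inE => /andP[].
  have [|cE lD] := maxD _ D'H (even_symdiff eD eC).
    apply/subsetP => v /DC[e eD' /andP[eC' ve]].
    by apply/bigcupP; exists e; rewrite ?in_symdiff ?eD' ?(negbTE eC').
  (* An edge of [C] off [D] would be in [W], with an endpoint that [D] misses and [symdiff D C]
     covers. Hence [C] is inside [D], and removing it contradicts the minimal size of [D]. *)
  have CD : C \subset D.
    apply/subsetP => e eC'; apply/idPn => eD'.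
    have : e \in X by apply: (subsetP CX).
    rewrite in_setU in_setD (negbTE eD') andbF orbF inE cE => /andP[_ /negP]; apply.
    by apply: bigcup_sup; rewrite in_symdiff eC' (negbTE eD').
  have : #|symdiff D C| < #|D|.
    apply: proper_card; apply/properP; split.
      by rewrite subUset subsetDl (subset_trans (subsetDl _ _) CD).
    have [e eC'] := set0Pn _ C0; exists e; first exact: (subsetP CD).
    by rewrite in_symdiff eC' (subsetP CD).
  by rewrite ltnNge lD.
pose B' := B :|: W.
have B'E : B' \subset edges G by rewrite subUset BE.
have B'D e : e \in B' -> e \notin D.
  rewrite in_setU => /orP[eB|eW]; last by rewrite (disjointFl DW eW).
  by apply: contraL eB => /(subsetP DH); rewrite inE => /andP[].
pose A := [set a : arc | arc_edge a \in B'] :|: O.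
have AB a : arc_edge a \in B' -> (a \in A) && (rev_arc a \in A).
  by move=> aB; rewrite !inE arc_edge_rev; rewrite !inE in aB; rewrite aB.
have AO a : arc_edge a \notin B' -> (a \in A) = (a \in O).
  by move=> aB; rewrite in_setU in_set (negbTE aB).
(* The pairing [g] fixes arcs off [D] and sends the reverse of an arc of [O] into [O], so it
   respects [A]. *)
exists A, g; split.
- apply/forallP => a; rewrite src_g eqxx /=; apply/eqP.
  have [aB|aB] := boolP (arc_edge a \in B').
    by rewrite fix_g ?B'D //; case/andP: (AB _ aB) => -> ->.
  have [aD|aD] := boolP (arc_edge a \in D); last first.
    rewrite fix_g // !AO ?arc_edge_rev //; move: aD.
    by rewrite DO negb_or => /andP[/negbTE-> /negbTE->].
  rewrite [RHS]AO ?arc_edge_rev // -gO AO //.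
  by apply/negP => /B'D; have := gD a; rewrite aD => ->.
(* A node covered by [D] is mixed because of an arc of [O]; at any other node all edges are in [B]
   or [W], so it is saturated. *)
- move=> v; have [/coverO[a [aO ta _]]|vW] := boolP (v \in cover D);
    apply/orP; [left|right].
    apply/existsP; exists (rev_arc a); rewrite src_rev ta eqxx rev_arcK /=.
    have aB : arc_edge a \notin B' by apply: contraL (OD _ aO) => /B'D.
    by rewrite !AO ?arc_edge_rev // aO (negbTE (antiO _ aO)).
  apply/forallP => a; apply/implyP => /eqP sa; apply: AB.
  have /andP[+ _] := arc_edge_incident a; rewrite !inE => /andP[-> _] /=.
  rewrite andbT; case: (_ \in B) => //=; apply: contra vW => /subsetP; apply.
  by rewrite -sa !inE eqxx.
- move=> S /set0Pn[u uS] ST; have [v vS] : exists v, v \notin S.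
    by move: ST; rewrite -properT => /properP[_ [v _ vS]]; exists v.
  have [x [y [xS yS xy]]] := connect_crossing (connB u v) uS vS.
  have [a ae] := arc_of_edge (subsetP BE _ xy).
  have aB : arc_edge a \in B' by rewrite ae inE xy.
  have : (src a \in [set x; y]) && (tgt a \in [set x; y]) by rewrite -ae !inE !eqxx orbT.
  have := src_neq_tgt a; have /andP[aA raA] := AB _ aB; move=> nst.
  rewrite !inE => /andP[/orP[] /eqP sE /orP[] /eqP tE]; rewrite sE tE ?eqxx // in nst.
    by exists a; rewrite sE tE.
  by exists (rev_arc a); rewrite src_rev tgt_rev sE tE rev_arcK.
have cO : #|O| <= #|D|.
  rewrite -(card_in_imset (f := @arc_edge T G)); last by move=> a b ? ? E; apply: revE.
  by apply/subset_leq_card/subsetP => _ /imsetP[a aO ->]; apply: OD.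
have cA : #|A| <= 2 * #|B| + 2 * #|W| + #|O|.
  apply: leq_trans (leq_card_setU _ _) _; rewrite leq_add2r card_arcs //.
  by rewrite -mulnDr leq_mul2l /= leq_card_setU.
have : #|W| + #|D| <= #|X| + #|N|.
  have -> : #|X| = #|W| + #|D :\: [set arc_edge a | a in N]|.
    rewrite cardsU [_ :&: _](_ : _ = set0) ?cards0 ?subn0 //.
    apply/setP => e; rewrite in_setI in_setD in_set0.
    by case eD': (e \in D); rewrite ?andbF // (disjointFr DW).
  rewrite -addnA leq_add2l -(cardsID [set arc_edge a | a in N] D) addnC leq_add2l.
  by apply: leq_trans (leq_imset_card _ _); apply: subset_leq_card; apply: subsetIr.
(* The chain is [3k <= 6b + 6(x + m - d) + 3o <= 6(b + x) + t <= 12(t - 1) + t]. *)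
have arith (b w o d x m t k : nat) : b < t -> x < t -> 6 * m <= 3 * o + t -> o <= d ->
    k <= 2 * b + 2 * w + o -> w + d <= x + m -> 3 * k + 12 <= 13 * t by lia.
exact: arith cB cX cN cO cA.
Qed.

(** The agent's nodes are the sources of the successive arcs of [F], starting from an arc that
    leaves [v]; any [#|F|] consecutive arcs exhaust the cycle. *)
Lemma face_walk (p : port_numbering G) (F : {set arc}) a0 :
    F = porbit (rh_perm p) a0 -> (forall v, exists2 a, a \in F & tgt a = v) ->
  witness_cycle p F /\
  forall v, exists x : nat -> T,
    [/\ rh_walk p x, x 0 = v & visits_all_with_period x #|F|].
Proof.
move=> FE visit; split.
  split; first by rewrite FE /rh_cycles /porbits imset_f.
  by move=> v; have [a aF <-] := visit v; exists a; rewrite // !inE eqxx orbT.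
have next a : src (rh_next p a) = tgt a by case/andP: (rh_nextP p a) => /eqP.
have permE a : rh_perm p a = rh_next p a by rewrite permE.
have visit' v : exists2 a, a \in F & src a = v.
  have [a aF <-] := visit v; exists (rh_next p a) => //.
  by rewrite -permE FE porbit_mem1 -FE.
move=> v; have [a aF av] := visit' v.
pose y t := iter t (rh_perm p) a.
have Fy t : F = porbit (rh_perm p) (y t).
  apply/eqP; rewrite FE eq_sym eq_porbit_mem -FE /y.
  by elim: t => //= t IH; rewrite FE porbit_mem1 -FE.
exists (fun t => src (y t)); split=> //.
  have yS t : y t.+1 = rh_next p (y t) by rewrite -permE.
  move=> t; rewrite !yS !next; split; first exact: (valP (y t)).
  by have /andP[_ /eqP] := rh_nextP p (y t); rewrite {1}/arc_edge next.
split.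
- by rewrite (cardD1 a) aF.
- by move=> t; rewrite /y addnC iterD -/(y t) (Fy t) iter_porbit.
move=> u t; have [b bF <-] := visit' u.
move: bF; rewrite {1}(Fy t) porbit_traject -Fy => /trajectP[i lt ->].
by exists (t + i); rewrite ?leq_addr ?ltn_add2l // /y addnC iterD.
Qed.

End Assembly.

Theorem theorem1 (T : finType) (G : sgraph T) (hconn : sg_connected G)
    (hn : 2 <= #|T|) :
  exists p : port_numbering G,
    (exists C : {set sg_arc G},
       witness_cycle p C /\
       (#|C|%:R <= (4 + 1 / 3) * #|T|%:R - 4 :> rat)%R) /\
    (forall v : T, exists x : nat -> T, exists k : nat,
       [/\ rh_walk p x, x 0 = v, visits_all_with_period x k
         & (k%:R <= (4 + 1 / 3) * #|T|%:R - 4 :> rat)%R]).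
Proof.
have [A [rho0 [rt0 cond conn cA]]] := balanced_arcs hconn hn.
have [rho [a0 [cyc FA visit]]] := face_visits_all cond conn hn rt0.
have [p pE] := rotation_port cyc.
have FE : porbit (face_perm rho) a0 = porbit (rh_perm p) a0.
  by congr (porbit _ a0); apply/permP => a; rewrite face_permE permE pE.
have [wF walkF] := face_walk FE visit.
have bound : (#|porbit (face_perm rho) a0|%:R <= (4 + 1 / 3) * #|T|%:R - 4 :> rat)%R.
  (* This is the bound multiplied by 3, since [3 * (4 + 1/3) = 13]. *)
  have : 3 * #|porbit (face_perm rho) a0| + 12 <= 13 * #|T|.
    by have := subset_leq_card FA; lia.
  rewrite -(Num.Theory.ler_nat rat) GRing.natrD !GRing.natrM; lra.
exists p; split; first by exists (porbit (face_perm rho) a0).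
by move=> v; have [x [? ? ?]] := walkF v; exists x, #|porbit (face_perm rho) a0|.
Qed.
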